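(* Let $n>2$ and $t\in\mathbb{C}^*$. With $Z_t$ and $L_t$ as in the context, consider the diagonal matrix $E_t=\mathrm{diag}(t,t,\dots,t,(1-n)t)\in Z_t$. Then $$L_t=\{UE_tU^{-1}\ |\ U\in U(n)\}.$$
   Context: Let $Z=\{A\in\mathfrak{sl}(n,\mathbb{C}) \mid \exists\, t\in\mathbb{C},\ \dim\ker(A-tI)\ge n-1\}$, let $\chi:Z\to\mathbb{C}$ take a matrix to the corresponding eigenvalue $t$, and let $Z_t=\chi^{-1}(t)$. The space $Z$ is singular only at the origin, and $\chi$ is a submersion away from $Z_0$. Equip $Z-\{0\}$ and the fibers $Z_t$, $t\ne0$, with the restriction of the standard Kähler form on the space of all $n\times n$ matrices $\cong\mathbb{C}^{n^2}$. Parallel transport along a path in $\mathbb{C}^*$ is the flow of the horizontal lift of the path's velocity, i.e. the lift orthogonal to the fibers of $\chi$. For $t\in\mathbb{C}^*$ let $\gamma(s)=(1-s)t$, $s\in[0,1]$, and let $h_{\gamma|[0,s]}$ denote parallel transport along $\gamma|_{[0,s]}$ for $s<1$. Then $L_t=\{y\in Z_t\mid h_{\gamma|[0,s]}\text{ is defined near }y\text{ for all }s<1,\ h_{\gamma|[0,s]}(y)\to0\text{ as }s\to1\}$. *)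

(* Defs.v *)
From HB Require Import structures.
From mathcomp Require Import all_boot all_order all_algebra.
From mathcomp Require Import complex spectral.
From mathcomp Require Import all_classical all_reals all_analysis.

Set Implicit Arguments.
Unset Strict Implicit.
Unset Printing Implicit Defensive.

Import Order.TTheory GRing.Theory Num.Theory.
Import numFieldNormedType.Exports.

Local Open Scope classical_set_scope.
Local Open Scope ring_scope.
Local Open Scope complex_scope.

Section ParallelTransport.
Context {R : realType} {n : nat}.
Implicit Types (A X Y : 'M[R[i]]_n) (t : R[i]).

(* [cokermx M] is a matrix whose columns span {x | M x = 0}. *)
Definition dim_ker (M : 'M[R[i]]_n) : nat := \rank (cokermx M).

Definition Z : set 'M[R[i]]_n :=
  [set A | \tr A = 0 /\ exists t : R[i], (n - 1 <= dim_ker (A - t%:M))%N].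

Definition Zreg : set 'M[R[i]]_n := Z `\` [set 0].

(* For n > 2 and A in Z, the eigenvalue t is unique. *)
Definition chi A : R[i] :=
  xget 0 [set t : R[i] | (n - 1 <= dim_ker (A - t%:M))%N].

Definition Zfiber t : set 'M[R[i]]_n := Z `&` chi @^-1` [set t].

(* The sum over the entries z = x + iy of dx /\ dy. *)
Definition kahler_form X Y : R :=
  \sum_i \sum_j (complex.Re (X i j) * complex.Im (Y i j) -
                  complex.Im (X i j) * complex.Re (Y i j)).

Definition kahler_metric X Y : R := kahler_form X ((0 +i* 1) *: Y).

Definition mxnorm X : R := Num.sqrt (kahler_metric X X).

Definition has_velocityC (f : R -> R[i]) (u : R) (w : R[i]) : Prop :=
  is_derive u 1 (fun x => complex.Re (f x)) (complex.Re w) /\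
  is_derive u 1 (fun x => complex.Im (f x)) (complex.Im w).

Definition has_velocity (c : R -> 'M[R[i]]_n) (u : R) (v : 'M[R[i]]_n) : Prop :=
  forall i j, has_velocityC (fun x => c x i j) u (v i j).

(* For S an embedded submanifold and A in S, the tangent space of S at A. *)
Definition tangent (S : set 'M[R[i]]_n) A : set 'M[R[i]]_n :=
  [set v | exists c : R -> 'M[R[i]]_n,
    [/\ c 0 = A, \forall u \near (0 : R), S (c u) & has_velocity c 0 v]].

(* v is tangent to Z - {0} at A and the differential of chi maps v to w. *)
Definition dchi A (v : 'M[R[i]]_n) (w : R[i]) : Prop :=
  exists c : R -> 'M[R[i]]_n,
    [/\ c 0 = A, \forall u \near (0 : R), Zreg (c u), has_velocity c 0 v
      & has_velocityC (chi \o c) 0 w].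

(* The fibers are complex submanifolds, so orthogonality for the metric and
   for the Kähler form agree here. *)
Definition horizontal_lift A (w : R[i]) (v : 'M[R[i]]_n) : Prop :=
  dchi A v w /\
  forall x, tangent (Zfiber (chi A)) A x -> kahler_metric v x = 0.

(* c is a horizontal lift to Z - {0} of the path g restricted to [0, s].
   Two-sided derivatives at 0 and s are no restriction: c is arbitrary outside
   [0, s], so a one-sided differentiable c can be extended affinely. *)
Definition horizontal_path (g : R -> R[i]) (s : R) (c : R -> 'M[R[i]]_n) : Prop :=
  forall u, 0 <= u <= s ->
    [/\ Zreg (c u), chi (c u) = g u &
        exists w v, [/\ has_velocityC g u w, has_velocity c u v
                      & horizontal_lift (c u) w v]].

Definition transports (g : R -> R[i]) (s : R) (y z : 'M[R[i]]_n) : Prop :=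
  exists c, [/\ horizontal_path g s c, c 0 = y & c s = z].

(* h_{g|[0,s]}(y); the value is 0 when the transport is undefined at y. *)
Definition parallel_transport (g : R -> R[i]) (s : R) (y : 'M[R[i]]_n) :
    'M[R[i]]_n :=
  xget 0 [set z | transports g s y z].

Definition transport_defined_near (g : R -> R[i]) (s : R) (y : 'M[R[i]]_n) : Prop :=
  exists2 e : R, 0 < e &
    forall y', Zfiber (g 0) y' -> mxnorm (y' - y) < e ->
      exists z, transports g s y' z.

Definition radial_path t : R -> R[i] := fun s => (1 - s)%:C * t.

Definition L_ t : set 'M[R[i]]_n :=
  [set y | [/\ Zfiber t y,
    forall s : R, 0 <= s < 1 -> transport_defined_near (radial_path t) s y &
    mxnorm (parallel_transport (radial_path t) s y) @[s --> (1 : R)^'-]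
      --> (0 : R)]].

Definition E_ t : 'M[R[i]]_n :=
  diag_mx (\row_(j < n) if j.+1 == n then (1 - n%:R) * t else t).

End ParallelTransport.

(* Main.v *)
Require Import Defs.
From mathcomp Require Import all_boot all_order all_algebra.
From mathcomp Require Import fingroup perm complex spectral.
From mathcomp Require Import all_classical all_reals all_analysis.
From mathcomp Require Import ring lra zify.

(** A point of the fiber over [t] is [A = t I + B] with [B] of rank one and trace
    [- n t], so that [B X B = \tr (B X) B] for every matrix [X].

    The theorem holds because parallel transport preserves the moment map
    [A A^* - A^* A] of the unitary group acting by conjugation. Indeed the fibers
    contain enough straight lines to force a horizontal vector [v] at [A] to commute
    with [A^*] ([horizontal_comm]), and the derivative of the moment map along [v] is
    [[v, A^*] + [A, v^*]] ([horizontal_moment]). If the transports of [y] tend to [0],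
    the moment map of [y] is therefore [0] ([vanishing_moment]): [y] is normal, and by
    the spectral theorem it is unitarily conjugate to [E_ t] ([normal_orbit]).
    Conversely, if [y] is conjugate to [E_ t], its transport at time [s] is a normal
    point of the fiber over [(1 - s) t], hence conjugate to [(1 - s) E_ t], and its
    norm tends to [0] ([orbit_vanishing]).

    The points of [L_ t] are moreover required to have neighborhoods on which
    transport is defined up to every time [s < 1]. In fact it is defined on the whole
    fiber ([transport_exists]), because horizontal paths can be written down. Commuting
    with the adjoint also suffices for being horizontal ([comm_horizontal]). If
    [B = w N] with [w] of modulus one and [N] of positive trace, one looks for a path
    [g I + w M] with [M = a N + b (N N^* + N^* N) + c N^*], where [a], [b], [c] are
    real functions. The rank bound, the value of the trace and the constancy of the
    moment map are three scalar equations, solved by square roots in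
    [transport_coeffs], and the last of them, once differentiated, is the commutation
    relation ([span3_comm]). *)

Import Order.TTheory GRing.Theory Num.Theory.
Import numFieldNormedType.Exports.
Local Open Scope classical_set_scope.
Local Open Scope ring_scope.

Set Implicit Arguments.
Unset Strict Implicit.
Unset Printing Implicit Defensive.

(** * Velocities of curves of complex numbers and matrices *)

Section Velocity.
Local Open Scope complex_scope.
Context {R : realType}.
Implicit Types (f g : R -> R[i]) (u : R) (z w : R[i]).

Lemma cReM z w :
  complex.Re (z * w) = complex.Re z * complex.Re w - complex.Im z * complex.Im w.
Proof. by case: z => a b; case: w. Qed.

Lemma cImM z w :
  complex.Im (z * w) = complex.Re z * complex.Im w + complex.Im z * complex.Re w.
Proof. by case: z => a b; case: w. Qed.

Lemma cReD z w : complex.Re (z + w) = complex.Re z + complex.Re w.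
Proof. by case: z => a b; case: w. Qed.

Lemma cImD z w : complex.Im (z + w) = complex.Im z + complex.Im w.
Proof. by case: z => a b; case: w. Qed.

Lemma cRe_sum (I : Type) (s : seq I) (F : I -> R[i]) :
  complex.Re (\sum_(i <- s) F i) = \sum_(i <- s) complex.Re (F i).
Proof. exact: (big_morph (fun z => complex.Re z) cReD). Qed.

Lemma cIm_sum (I : Type) (s : seq I) (F : I -> R[i]) :
  complex.Im (\sum_(i <- s) F i) = \sum_(i <- s) complex.Im (F i).
Proof. exact: (big_morph (fun z => complex.Im z) cImD). Qed.

Lemma complex_ext z w :
  complex.Re z = complex.Re w -> complex.Im z = complex.Im w -> z = w.
Proof. by case: z => a b; case: w => c d /= -> ->. Qed.

Lemma velocityC_cst z u : has_velocityC (fun=> z) u 0.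
Proof. by split; exact: is_derive_cst. Qed.

Lemma velocityC_real (h : R -> R) u (dh : R) :
  is_derive u 1 h dh -> has_velocityC (fun x => (h x)%:C) u dh%:C.
Proof. by split => //=; exact: is_derive_cst. Qed.

Lemma velocityCD f g u z w :
  has_velocityC f u z -> has_velocityC g u w ->
  has_velocityC (fun x => f x + g x) u (z + w).
Proof.
move=> [fr fi] [gr gi]; split.
  by under eq_fun do rewrite cReD; rewrite cReD; exact: is_deriveD.
by under eq_fun do rewrite cImD; rewrite cImD; exact: is_deriveD.
Qed.

Lemma velocityCM f g u z w :
  has_velocityC f u z -> has_velocityC g u w ->
  has_velocityC (fun x => f x * g x) u (z * g u + f u * w).
Proof.
move=> [fr fi] [gr gi]; split.
  under eq_fun do rewrite cReM.
  apply: (is_derive_eq (is_deriveB (is_deriveM fr gr) (is_deriveM fi gi))).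
  by rewrite cReD !cReM /GRing.scale/=; ring.
under eq_fun do rewrite cImM.
apply: (is_derive_eq (is_deriveD (is_deriveM fr gi) (is_deriveM fi gr))).
by rewrite cImD !cImM /GRing.scale/=; ring.
Qed.

Lemma cReJ z : complex.Re (Num.conj z) = complex.Re z.
Proof. by case: z. Qed.

Lemma cImJ z : complex.Im (Num.conj z) = - complex.Im z.
Proof. by case: z. Qed.

Lemma velocityC_conj f u z :
  has_velocityC f u z -> has_velocityC (fun x => Num.conj (f x)) u (Num.conj z).
Proof.
move=> [fr fi]; split.
  by under eq_fun do rewrite cReJ; rewrite cReJ.
by under eq_fun do rewrite cImJ; rewrite cImJ; exact: is_deriveN.
Qed.

Lemma velocityC_sum (I : Type) (s : seq I) (F : I -> R -> R[i]) (z : I -> R[i]) u :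
  (forall i, has_velocityC (F i) u (z i)) ->
  has_velocityC (fun x => \sum_(i <- s) F i x) u (\sum_(i <- s) z i).
Proof.
move=> Fz; elim: s => [|i s IH].
  rewrite big_nil; under eq_fun do rewrite big_nil; exact: velocityC_cst.
by rewrite big_cons; under eq_fun do rewrite big_cons; exact: velocityCD.
Qed.

Lemma velocityC_uniq f u z w :
  has_velocityC f u z -> has_velocityC f u w -> z = w.
Proof.
move=> [fr fi] [fr' fi']; apply: complex_ext.
  by rewrite -(@derive_val _ _ _ _ _ _ _ fr) (@derive_val _ _ _ _ _ _ _ fr').
by rewrite -(@derive_val _ _ _ _ _ _ _ fi) (@derive_val _ _ _ _ _ _ _ fi').
Qed.

Lemma velocityC_near f g u z :
  (\forall x \near u, f x = g x) -> has_velocityC f u z -> has_velocityC g u z.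
Proof.
move=> fg [fr fi]; split.
  by apply: near_eq_is_derive fr; apply: filterS fg => x ->.
by apply: near_eq_is_derive fi; apply: filterS fg => x ->.
Qed.

Lemma velocityC_shift f u z :
  has_velocityC f u z -> has_velocityC (fun x => f (u + x)) 0 z.
Proof.
have sh (h : R -> R) (dh : R) : is_derive u 1 h dh ->
    is_derive (0 : R) (1 : R) (fun x => h (u + x)) dh.
  move=> hd; have hd' : is_derive (u + 0) (1 : R) h dh by rewrite addr0.
  have su : is_derive (0 : R) (1 : R) (fun x : R => u + x) (0 + 1).
    exact: (@is_deriveD _ _ _ (cst u) id 0 1 0 1 (is_derive_cst _ _ _) (is_derive_id _ _)).
  by have := is_derive1_comp hd' su; rewrite add0r mulr1.
by move=> [fr fi]; split; exact: sh.
Qed.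

(** The mean value theorem, applied to the real and imaginary parts. *)
Lemma velocityC0_const f (a b : R) : a <= b ->
  (forall u, a <= u <= b -> has_velocityC f u 0) -> f a = f b.
Proof.
move=> ab f0.
have cst (h : R -> R) : (forall u, a <= u <= b -> is_derive u 1 h 0) -> h a = h b.
  move=> hd; have [||c _] := @MVT_segment _ h (fun=> 0) a b ab.
  - by move=> x; rewrite in_itv/= => /andP[/ltW ax /ltW xb]; apply: hd; rewrite ax.
  - apply: derivable_within_continuous => x; rewrite in_itv/= => xab.
    by have [] := hd x xab.
  - by rewrite mul0r => /eqP; rewrite subr_eq0 => /eqP ->.
apply: complex_ext.
  by apply: (cst (fun x => complex.Re (f x))) => u /f0 [].
by apply: (cst (fun x => complex.Im (f x))) => u /f0 [].
Qed.

End Velocity.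

Section MatrixVelocity.
Local Open Scope complex_scope.
Local Open Scope sesquilinear_scope.
Context {R : realType} {n : nat}.
Implicit Types (c d : R -> 'M[R[i]]_n) (u : R) (v w : 'M[R[i]]_n).

Lemma velocity_cst v u : has_velocity (fun=> v) u 0.
Proof. by move=> i j; rewrite mxE; exact: velocityC_cst. Qed.

Lemma velocityD c d u v w :
  has_velocity c u v -> has_velocity d u w ->
  has_velocity (fun x => c x + d x) u (v + w).
Proof.
move=> cv dw i j; rewrite mxE; under eq_fun do rewrite mxE.
exact: velocityCD.
Qed.

Lemma velocityZ (f : R -> R[i]) u z v :
  has_velocityC f u z -> has_velocity (fun x => f x *: v) u (z *: v).
Proof.
move=> fz i j; rewrite mxE; under eq_fun do rewrite mxE.
rewrite -[X in has_velocityC _ _ X]addr0 -[X in _ + X](mulr0 (f u)).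
by apply: velocityCM => //; exact: velocityC_cst.
Qed.

Lemma velocityM c d u v w :
  has_velocity c u v -> has_velocity d u w ->
  has_velocity (fun x => c x *m d x) u (v *m d u + c u *m w).
Proof.
move=> cv dw i j; rewrite !mxE -big_split/=; under eq_fun do rewrite mxE.
by apply: velocityC_sum => k; exact: velocityCM.
Qed.

Lemma velocity_adj c u v :
  has_velocity c u v -> has_velocity (fun x => (c x)^t*) u (v^t*).
Proof.
move=> cv i j; rewrite !mxE; under eq_fun do rewrite !mxE.
exact: velocityC_conj.
Qed.

Lemma velocity_scale z c u v :
  has_velocity c u v -> has_velocity (fun x => z *: c x) u (z *: v).
Proof.
move=> cv; have := velocityM (velocity_cst z%:M u) cv.
by rewrite mul0mx add0r mul_scalar_mx; under eq_fun do rewrite mul_scalar_mx.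
Qed.

Lemma velocityN c u v : has_velocity c u v -> has_velocity (fun x => - c x) u (- v).
Proof.
move=> /(velocity_scale (-1)); rewrite scaleN1r.
by under eq_fun do rewrite scaleN1r.
Qed.

Lemma velocity_uniq c u v w : has_velocity c u v -> has_velocity c u w -> v = w.
Proof. by move=> cv cw; apply/matrixP => i j; exact: velocityC_uniq. Qed.

Lemma velocity_near c d u v :
  (\forall x \near u, c x = d x) -> has_velocity c u v -> has_velocity d u v.
Proof.
move=> cd cv i j; apply: velocityC_near (cv i j).
by apply: filterS cd => x ->.
Qed.

Lemma velocity0_const c (a b : R) : a <= b ->
  (forall u, a <= u <= b -> has_velocity c u 0) -> c a = c b.
Proof.
move=> ab c0; apply/matrixP => i j.
apply: (velocityC0_const (f := fun x => c x i j)) ab _ => u /c0 /(_ i j).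
by rewrite mxE.
Qed.

Lemma velocity_shift c u v :
  has_velocity c u v -> has_velocity (fun x => c (u + x)) 0 v.
Proof. by move=> cv i j; have := velocityC_shift (cv i j). Qed.

End MatrixVelocity.

(** * Adjoints, rank one matrices and the fibers of chi *)

Section Adjoint.
Local Open Scope complex_scope.
Local Open Scope sesquilinear_scope.
Context {R : realType} {n : nat}.
Implicit Types (A B X Y : 'M[R[i]]_n) (z : R[i]).

Lemma adjM A B : (A *m B)^t* = B^t* *m A^t*.
Proof. by rewrite trmx_mul map_mxM. Qed.

Lemma adjD A B : (A + B)^t* = A^t* + B^t*.
Proof. by rewrite linearD map_mxD. Qed.

Lemma adjN A : (- A)^t* = - A^t*.
Proof. by rewrite linearN map_mxN. Qed.

Lemma adjZ z A : (z *: A)^t* = Num.conj z *: A^t*.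
Proof. by rewrite linearZ map_mxZ. Qed.

Lemma adj_scalar z : (z%:M)^t* = (Num.conj z)%:M :> 'M[R[i]]_n.
Proof. by rewrite tr_scalar_mx map_scalar_mx. Qed.

Lemma adj0 : (0 : 'M[R[i]]_n)^t* = 0.
Proof. by rewrite trmx0 map_mx0. Qed.

Lemma adjK : involutive (fun A => A^t*).
Proof. by move=> A; rewrite trmxCK. Qed.

Lemma tr_adj A : \tr (A^t*) = Num.conj (\tr A).
Proof.
rewrite -[X in _ = Num.conj X]mxtrace_tr /mxtrace rmorph_sum.
by apply: eq_bigr => i _; rewrite mxE.
Qed.

Lemma conj_real (x : R) : Num.conj x%:C = x%:C :> R[i].
Proof. by apply: complex_ext; rewrite ?cReJ ?cImJ //= oppr0. Qed.

Lemma kahler_metricE X Y : kahler_metric X Y = complex.Re (\tr (X^t* *m Y)).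
Proof.
have -> : \tr (X^t* *m Y) = \sum_i \sum_j Num.conj (X i j) * Y i j.
  rewrite /mxtrace exchange_big/=; apply: eq_bigr => i _.
  by rewrite mxE; apply: eq_bigr => j _; rewrite !mxE.
rewrite /kahler_metric /kahler_form cRe_sum; apply: eq_bigr => i _.
rewrite cRe_sum; apply: eq_bigr => j _.
by rewrite mxE !cReM !cImM cReJ cImJ /=; ring.
Qed.

Lemma kahler_normE X : kahler_metric X X =
  \sum_i \sum_j (complex.Re (X i j) ^+ 2 + complex.Im (X i j) ^+ 2).
Proof.
rewrite /kahler_metric /kahler_form; apply: eq_bigr => i _; apply: eq_bigr => j _.
by rewrite mxE !cReM !cImM /=; ring.
Qed.

Lemma kahler_norm_ge X i j :
  complex.Re (X i j) ^+ 2 + complex.Im (X i j) ^+ 2 <= kahler_metric X X.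
Proof.
have p i' j' : 0 <= complex.Re (X i' j') ^+ 2 + complex.Im (X i' j') ^+ 2.
  by rewrite addr_ge0 ?sqr_ge0.
rewrite kahler_normE (bigD1 i)//= (bigD1 j)//= -addrA lerDl addr_ge0 ?sumr_ge0//.
by move=> k _; rewrite sumr_ge0.
Qed.

Lemma kahler_norm_ge0 X : 0 <= kahler_metric X X.
Proof.
rewrite kahler_normE sumr_ge0// => i _; rewrite sumr_ge0// => j _.
by rewrite addr_ge0 ?sqr_ge0.
Qed.

Lemma kahler_norm_eq0 X : kahler_metric X X = 0 -> X = 0.
Proof.
move=> X0; apply/matrixP => i j; rewrite mxE.
have := kahler_norm_ge X i j; rewrite X0 => le0.
have := sqr_ge0 (complex.Re (X i j)); have := sqr_ge0 (complex.Im (X i j)) => Im0 Re0.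
by apply: complex_ext => /=; apply/eqP; rewrite -sqrf_eq0; apply/eqP; lra.
Qed.

Lemma tr_adj_mul X : \tr (X^t* *m X) = (kahler_metric X X)%:C.
Proof.
apply: complex_ext; rewrite ?kahler_metricE //=.
have : Num.conj (\tr (X^t* *m X)) = \tr (X^t* *m X) by rewrite -tr_adj adjM adjK.
move/(congr1 (fun z => complex.Im z)); rewrite cImJ => h; lra.
Qed.

End Adjoint.

Section RankOne.
Context {F : fieldType} {n : nat}.
Implicit Types (A B X Y : 'M[F]_n) (t : F).

(** Writing [B] as a column [u] times a row [v] turns [B X B] into [u (v X u) v],
    where [v X u] is the scalar [\tr (B X)]. *)
Lemma rank1_sandwich B X : (\rank B <= 1)%N -> B *m X *m B = \tr (B *m X) *: B.
Proof.
have key (k : nat) (u : 'M[F]_(n, k)) (v : 'M[F]_(k, n)) : (k <= 1)%N ->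
    (u *m v) *m X *m (u *m v) = \tr (u *m v *m X) *: (u *m v).
  case: k u v => [|[|//]] u v _.
    by rewrite [u]thinmx0 !mul0mx scaler0.
  have -> : u *m v *m X *m (u *m v) = u *m (v *m X *m u) *m v by rewrite !mulmxA.
  rewrite -[u *m v *m X]mulmxA [\tr _]mxtrace_mulC [v *m X *m u]mx11_scalar.
  by rewrite mul_mx_scalar -scalemxAl mxtrace_scalar mulr1n.
by rewrite -(mulmx_base B) => rk; apply: key; rewrite mulmx_base in rk.
Qed.

(** Two shifts of [A] of rank at most one differ by a scalar matrix of rank at
    most two, and a nonzero scalar matrix has rank [n]: this is where [n > 2]
    enters, and it makes [chi] the eigenvalue on all of [Z]. *)
Lemma rank1_shift_unique A t t' : (2 < n)%N ->
  (\rank (A - t%:M)%R <= 1)%N -> (\rank (A - t'%:M)%R <= 1)%N -> t = t'.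
Proof.
move=> n_gt2 rt rt'; apply/eqP/negP => /negP tt'.
have : (\rank ((t - t')%:M : 'M[F]_n)%R <= 2)%N.
  have -> : (t - t')%:M = (A - t'%:M) - (A - t%:M) :> 'M[F]_n.
    by apply/matrixP => i j; rewrite !mxE mulrnBl; ring.
  by apply: leq_trans (mxrank_add _ _) _; rewrite mxrank_opp; exact: (leq_add rt' rt).
rewrite -scalemx1 mxrank_scale_nz ?subr_eq0// mxrank1 leqNgt n_gt2 //.
Qed.

End RankOne.

Section Fiber.
Local Open Scope complex_scope.
Local Open Scope sesquilinear_scope.
Context {R : realType} {n : nat}.
Context (n_gt2 : (2 < n)%N).
Implicit Types (A B X Y : 'M[R[i]]_n) (t : R[i]).

Lemma dim_ker_rank A : (n - 1 <= dim_ker A)%N = (\rank A <= 1)%N.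
Proof. by rewrite /dim_ker mxrank_coker; have := rank_leq_row A; lia. Qed.

Lemma chiE A t : (\rank (A - t%:M)%R <= 1)%N -> chi A = t.
Proof.
move=> rk; rewrite /chi; case: xgetP => [t' _ /=|/(_ t)/=]; rewrite dim_ker_rank.
  by move=> rk'; apply: rank1_shift_unique rk' rk.
by [].
Qed.

Lemma ZfiberP A t : Zfiber t A <-> \tr A = 0 /\ (\rank (A - t%:M)%R <= 1)%N.
Proof.
split.
  move=> [[trA [s]]]; rewrite dim_ker_rank => rk /=; rewrite (chiE rk) => <-.
  by split.
move=> [trA rk]; split; last by rewrite /= (chiE rk).
by split => //; exists t; rewrite dim_ker_rank.
Qed.

Lemma Zfiber_neq0 A t : t != 0 -> Zfiber t A -> A != 0.
Proof.
move=> t0 /ZfiberP[_ rk]; apply/eqP => A0; move: rk; rewrite A0 sub0r mxrank_opp.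
by rewrite -scalemx1 mxrank_scale_nz// mxrank1; lia.
Qed.

Lemma Zfiber_Zreg A t : t != 0 -> Zfiber t A -> Zreg A.
Proof. by move=> t0 AZ; split; [case: AZ|exact/eqP/(Zfiber_neq0 t0 AZ)]. Qed.

Lemma Zreg_Zfiber A : Zreg A -> Zfiber (chi A) A.
Proof. by case. Qed.

Lemma Zfiber_trace A t : Zfiber t A -> \tr (A - t%:M) = - (n%:R * t).
Proof.
by move=> /ZfiberP[trA _]; rewrite raddfB/= trA mxtrace_scalar sub0r mulr_natl.
Qed.

End Fiber.

(** * Horizontal vectors *)

(** When [c *: B] is a projector, the hypotheses kill the two off-diagonal corners
    of [X] in the corresponding block decomposition. *)
Lemma comm_of_corners (F : fieldType) (n : nat) (B X : 'M[F]_n) (c : F) :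
  B *m X *m (1%:M - c *: B) = 0 -> (1%:M - c *: B) *m X *m B = 0 ->
  B *m X = X *m B.
Proof.
rewrite mulmxBr mulmx1 -scalemxAr => /subr0_eq H1.
rewrite !mulmxBl mul1mx -!scalemxAl => /subr0_eq H2.
by rewrite H1 H2.
Qed.

Section Horizontal.
Local Open Scope complex_scope.
Local Open Scope sesquilinear_scope.
Context {R : realType} {n : nat}.
Context (n_gt2 : (2 < n)%N).
Implicit Types (A B X Y : 'M[R[i]]_n) (t : R[i]).

Lemma trace_neq0 t : t != 0 -> - (n%:R * t) != 0.
Proof. by move=> t0; rewrite oppr_eq0 mulf_neq0// pnatr_eq0; lia. Qed.

Lemma Zfiber_sqr A t : Zfiber t A ->
  (A - t%:M) *m (A - t%:M) = - (n%:R * t) *: (A - t%:M).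
Proof.
move=> At; rewrite -(Zfiber_trace n_gt2 At).
have [_ rk] := (ZfiberP n_gt2 A t).1 At.
by have := rank1_sandwich 1%:M rk; rewrite !mulmx1.
Qed.

(** A straight line keeping the trace and the rank bound stays in the fiber, so its
    direction is tangent; such lines are all that [horizontal_comm] tests against. *)
Lemma Zfiber_line A t X : Zfiber t A -> \tr X = 0 ->
  (forall z, (\rank (A - t%:M + z *: X)%R <= 1)%N) ->
  tangent (Zfiber t) A X.
Proof.
move=> At trX rk; exists (fun u => A + u%:C *: X); split.
- by rewrite scale0r addr0.
- apply: (@filterE _ (nbhs (0 : R))) => u; apply/(ZfiberP n_gt2); split.
    by case/(ZfiberP n_gt2): At => trA _; rewrite mxtraceD mxtraceZ trA trX mulr0 addr0.
  by rewrite addrAC.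
- rewrite -[X in has_velocity _ _ X]add0r -[X in _ + X](scale1r X).
  apply: velocityD; first exact: velocity_cst.
  by apply: velocityZ; apply: (velocityC_real (dh := 1)); exact: is_derive_id.
Qed.

(** With [B = A - t] and [Q] the projector [1 - B / \tr B], the lines
    [A + z Q Y B] and [A + z B Y Q] lie in the fiber because [B Q = Q B = 0].
    Orthogonality of [v] to their directions for a well chosen [Y] kills both
    corners [B v^* Q] and [Q v^* B]. *)
Lemma horizontal_comm A t v : t != 0 -> Zfiber t A ->
  (forall x, tangent (Zfiber t) A x -> kahler_metric v x = 0) ->
  v *m A^t* = A^t* *m v.
Proof.
move=> t0 At orth; set B := A - t%:M; set tau := - (n%:R * t).
have tau0 : tau != 0 by exact: trace_neq0.
have BB : B *m B = tau *: B by exact: Zfiber_sqr.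
have [_ rkB] := (ZfiberP n_gt2 A t).1 At.
pose Q := 1%:M - tau^-1 *: B.
have BQ : B *m Q = 0.
  by rewrite mulmxBr mulmx1 -scalemxAr BB scalerA mulVf// scale1r subrr.
have QB : Q *m B = 0.
  by rewrite mulmxBl mul1mx -scalemxAl BB scalerA mulVf// scale1r subrr.
have W1 : B *m v^t* *m Q = 0.
  set W := _ *m Q; apply: (can_inj (@adjK R n)); rewrite adj0.
  (* Y is the adjoint of the corner, so that orthogonality reads |W|^2 = 0 *)
  apply: kahler_norm_eq0; rewrite -(orth (Q *m W^t* *m B)).
    rewrite !kahler_metricE adjK; congr (complex.Re _).
    by rewrite mulmxA [RHS]mxtrace_mulC !mulmxA.
  apply: Zfiber_line => // [|z].
    by rewrite mxtrace_mulC mulmxA BQ mul0mx mxtrace0.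
  rewrite -/B -[X in X + _]mul1mx scalemxAl -mulmxDl.
  exact: leq_trans (mxrankM_maxr _ _) rkB.
have W2 : Q *m v^t* *m B = 0.
  set W := _ *m B; apply: (can_inj (@adjK R n)); rewrite adj0.
  apply: kahler_norm_eq0; rewrite -(orth (B *m W^t* *m Q)).
    rewrite !kahler_metricE adjK; congr (complex.Re _).
    by rewrite mulmxA [RHS]mxtrace_mulC !mulmxA.
  apply: Zfiber_line => // [|z].
    by rewrite mxtrace_mulC mulmxA QB mul0mx mxtrace0.
  rewrite -/B -[X in X + _]mulmx1 -mulmxA scalemxAr -mulmxDr.
  exact: leq_trans (mxrankM_maxl _ _) rkB.
have comm : B *m v^t* = v^t* *m B.
  exact: comm_of_corners W1 W2.
have vB : v *m B^t* = B^t* *m v.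
  by rewrite -[v in LHS]adjK -[v in RHS]adjK -!adjM comm.
have -> : A^t* = B^t* + (Num.conj t)%:M by rewrite -adj_scalar -adjD subrK.
by rewrite mulmxDr mulmxDl vB scalar_mxC.
Qed.

(** Differentiating [B B = \tr B B] along the fiber gives
    [B x + x B = \tr B x] for a tangent vector [x], hence [B x B = 0]: a tangent
    vector has only off-diagonal corners with respect to [B], whereas [v^*],
    commuting with [B], has none. *)
Lemma comm_horizontal A t v x : t != 0 -> Zfiber t A ->
  v *m A^t* = A^t* *m v -> tangent (Zfiber t) A x -> kahler_metric v x = 0.
Proof.
move=> t0 At vA [c [c0 cZ cx]]; set B := A - t%:M; set tau := - (n%:R * t).
have tau0 : tau != 0 by exact: trace_neq0.
have BB : B *m B = tau *: B by exact: Zfiber_sqr.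
have vB : v^t* *m B = B *m v^t*.
  have := congr1 (fun M => M^t*) vA; rewrite !adjM adjK => vA'.
  by rewrite mulmxBr mulmxBl vA' scalar_mxC.
have dc : has_velocity (fun u => c u - t%:M) 0 x.
  rewrite -[x]addr0; apply: velocityD => //; exact: velocity_cst.
have dcc : x *m B + B *m x = tau *: x.
  have := velocityM dc dc; rewrite c0 => dcc; apply: (velocity_uniq dcc).
  apply: (velocity_near _ (_ : has_velocity (fun u => tau *: (c u - t%:M)) 0 _)).
    by apply: filterS cZ => u /Zfiber_sqr.
  exact: velocity_scale.
have BxB : B *m x *m B = 0.
  move: (congr1 (mulmx B) dcc); rewrite mulmxDr !mulmxA BB -scalemxAl -scalemxAr.
  by move/eqP; rewrite -subr_eq0 addrK => /eqP.
have trB : \tr (v^t* *m B *m x) = 0.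
  apply: (mulfI tau0); rewrite mulr0 -mxtraceZ scalemxAl scalemxAr -BB.
  rewrite (mulmxA (v^t*)) vB -(mulmxA B) -(mulmxA B) mxtrace_mulC.
  by rewrite -!mulmxA (mulmxA B) BxB mulmx0 mxtrace0.
rewrite kahler_metricE.
have -> : \tr (v^t* *m x) = 0 => //.
apply: (mulfI tau0); rewrite mulr0 -mxtraceZ scalemxAr -dcc mulmxDr mxtraceD.
by rewrite !mulmxA trB addr0 mxtrace_mulC mulmxA -vB.
Qed.

End Horizontal.

(** * The moment map and the normal points of a fiber *)

Section MomentMap.
Local Open Scope complex_scope.
Local Open Scope sesquilinear_scope.
Context {R : realType} {n : nat}.
Context (n_gt2 : (2 < n)%N).
Implicit Types (A B X Y : 'M[R[i]]_n) (t : R[i]).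

(** Up to the factor [i], the moment map of the conjugation action of the unitary
    group on matrices; its zeros are the normal matrices. *)
Definition moment A := A *m A^t* - A^t* *m A.

Lemma radial_neq0 t (u : R) : t != 0 -> u < 1 -> radial_path t u != 0.
Proof.
move=> t0 u1; rewrite mulf_neq0// eq_complex /= negb_and subr_eq0.
by rewrite eq_sym lt_eqF.
Qed.

(** The derivative is [[v, A^*] + [A, v^*]], and both brackets vanish because the
    velocity [v] is horizontal. *)
Lemma horizontal_moment t s c : t != 0 -> 0 <= s < 1 ->
  horizontal_path (radial_path t) s c -> moment (c 0) = moment (c s).
Proof.
move=> t0 /andP[s0 s1] hc.
apply: (velocity0_const (c := fun u => moment (c u))) s0 _ => u us.
have [reg chiu [w [v [_ cv [_ orth]]]]] := hc u us.
have gu0 : radial_path t u != 0.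
  by apply: radial_neq0 => //; case/andP: us => _ /le_lt_trans; exact.
have comm : v *m (c u)^t* = (c u)^t* *m v.
  apply: (horizontal_comm n_gt2 gu0); first by rewrite -chiu; exact: Zreg_Zfiber.
  by move=> x; rewrite -chiu; exact: orth.
have comm' : c u *m v^t* = v^t* *m c u.
  by have := congr1 (fun M => M^t*) comm; rewrite !adjM adjK.
have cv' := velocity_adj cv.
have -> : 0 = v *m (c u)^t* + c u *m v^t* - (v^t* *m c u + (c u)^t* *m v).
  by rewrite comm comm' [X in X - _]addrC subrr.
apply: velocityD; first exact: velocityM.
by apply: velocityN; exact: velocityM.
Qed.

(** Quantitative continuity of the moment map at the origin. *)
Lemma moment_bound A i j (N := kahler_metric A A) :
  `|complex.Re (moment A i j)| <= N *+ (2 * n) /\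
  `|complex.Im (moment A i j)| <= N *+ (2 * n).
Proof.
have reb (z w : R[i]) :
    complex.Re z ^+ 2 + complex.Im z ^+ 2 <= N ->
    complex.Re w ^+ 2 + complex.Im w ^+ 2 <= N ->
    `|complex.Re (z * w)| <= N /\ `|complex.Im (z * w)| <= N.
  rewrite cReM cImM; case: z => a b; case: w => p q /= zN wN.
  by split; rewrite ler_norml; apply/andP; split;
    have := sqr_ge0 (a - p); have := sqr_ge0 (a + p);
    have := sqr_ge0 (b - q); have := sqr_ge0 (b + q);
    have := sqr_ge0 (a - q); have := sqr_ge0 (a + q);
    have := sqr_ge0 (b - p); have := sqr_ge0 (b + p); nra.
have eN i' j' : complex.Re (A i' j') ^+ 2 + complex.Im (A i' j') ^+ 2 <= N.
  exact: kahler_norm_ge.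
have eN' i' j' :
    complex.Re (Num.conj (A i' j')) ^+ 2 + complex.Im (Num.conj (A i' j')) ^+ 2 <= N.
  by rewrite cReJ cImJ sqrrN.
have sb (F : 'I_n -> R) : (forall k, `|F k| <= N) -> `|\sum_k F k| <= N *+ n.
  move=> FN; apply: le_trans (ler_norm_sum _ _ _) _.
  by apply: le_trans (ler_sum _ (fun k _ => FN k)) _; rewrite sumr_const card_ord.
have split2 (a b : R) : `|a| <= N *+ n -> `|b| <= N *+ n -> `|a - b| <= N *+ (2 * n).
  move=> aN bN; apply: le_trans (ler_normB _ _) _.
  by rewrite mul2n -addnn mulrnDr lerD.
have ReB (z w : R[i]) : complex.Re (z - w) = complex.Re z - complex.Re w.
  by case: z; case: w.
have ImB (z w : R[i]) : complex.Im (z - w) = complex.Im z - complex.Im w.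
  by case: z; case: w.
rewrite !mxE; split; rewrite ?ReB ?ImB ?cRe_sum ?cIm_sum; apply: split2; apply: sb => k;
  rewrite !mxE; by [apply: (reb _ _ _ _).1|apply: (reb _ _ _ _).2].
Qed.

Lemma normal_moment A : (A \is normalmx) = (moment A == 0).
Proof. by rewrite qualifE /= subr_eq0. Qed.

End MomentMap.

Section NormalForm.
Local Open Scope complex_scope.
Local Open Scope sesquilinear_scope.
Context {R : realType} {n : nat}.
Context (n_gt2 : (2 < n)%N).
Implicit Types (A B X Y U : 'M[R[i]]_n) (t : R[i]).

Lemma perm_unitary (s : {perm 'I_n}) : (perm_mx s : 'M[R[i]]_n) \is unitarymx.
Proof.
apply/unitarymxP; rewrite tr_perm_mx map_perm_mx -perm_mxM mulgV.
exact: perm_mx1.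
Qed.

Lemma EtE t i j : (E_ t : 'M[R[i]]_n) i j =
  (if i.+1 == n then (1 - n%:R) * t else t) *+ (i == j).
Proof. by rewrite !mxE. Qed.

(** Let [b] be the diagonal of [A - t] in an orthonormal eigenbasis. Sandwiching an
    elementary matrix [E_ij] gives [b_i b_j = 0] for [i != j], so a single entry
    [b_k] is nonzero, and it is the trace [- n t]. *)
Lemma normal_diag t A : t != 0 -> Zfiber t A -> A \is normalmx ->
  exists k, A = invmx (spectralmx A) *m
    diag_mx (\row_j if j == k then (1 - n%:R) * t else t) *m spectralmx A.
Proof.
move=> t0 At /orthomx_spectralP; set P := spectralmx A; set d := spectral_diag A.
move=> Ad.
have Pu : P \in unitmx by exact/unitarymx_unit/spectral_unitarymx.
pose b := d - const_mx t.
have Db : diag_mx b = P *m (A - t%:M) *m invmx P.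
  rewrite mulmxBr mulmxBl {1}Ad !mulmxA mulmxV// mul1mx mulmxK//.
  by rewrite scalar_mxC mulmxK// raddfB/= diag_const_mx.
have rk : (\rank (diag_mx b) <= 1)%N.
  rewrite Db; apply: leq_trans (mxrankM_maxl _ _) _.
  apply: leq_trans (mxrankM_maxr _ _) _.
  by case/(ZfiberP n_gt2): At.
have bb i j : i != j -> b 0 i * b 0 j = 0.
  move=> ij.
  have := congr1 (fun M => fun_of_matrix M i j) (rank1_sandwich (delta_mx i j) rk).
  rewrite mul_diag_mx mul_mx_diag !mxE (negbTE ij) mulr0n mulr0 !eqxx/= mulr1.
  by [].
have trb : \sum_i b 0 i = - (n%:R * t).
  rewrite -mxtrace_diag Db mxtrace_mulC mulmxA mulVmx// mul1mx.
  exact: Zfiber_trace.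
have [k bk] : exists k, b 0 k != 0.
  apply/existsP; apply: contraNT (trace_neq0 n_gt2 t0) => /existsPn b0.
  by rewrite -trb big1// => i _; apply/eqP; move: (b0 i); rewrite negbK.
have bj j : j != k -> b 0 j = 0.
  by move=> jk; have /eqP := bb _ _ jk; rewrite mulf_eq0 (negbTE bk) orbF => /eqP.
exists k; rewrite [LHS]Ad; congr (invmx P *m diag_mx _ *m P).
apply/rowP => j; rewrite mxE.
have -> : d 0 j = b 0 j + t by rewrite !mxE subrK.
case: eqP => [->|/eqP/bj ->]; last by rewrite add0r.
move: trb; rewrite (bigD1 k)//= big1 => [|i /bj //]; rewrite addr0 => ->.
by rewrite mulrBl mul1r addrC.
Qed.

Lemma normal_orbit t A : t != 0 -> Zfiber t A -> A \is normalmx ->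
  exists2 U, U \is unitarymx & U *m E_ t *m invmx U = A.
Proof.
move=> t0 At nA; have [k Ak] := normal_diag t0 At nA.
move: (spectralmx A) (spectral_unitarymx A) Ak => P Pun Ak.
have lt1 : (n.-1 < n)%N by lia.
pose s := tperm k (Ordinal lt1).
have Uun : invmx P *m perm_mx s \is unitarymx.
  apply: mul_unitarymx; last exact: perm_unitary.
  by rewrite (invmx_unitary Pun) trmxC_unitary.
(* the exceptional eigenvalue is moved from position k to the last one *)
exists (invmx P *m perm_mx s) => //.
rewrite (invmx_unitary Uun) (invmx_unitary Pun) adjM adjK tr_perm_mx map_perm_mx.
rewrite [RHS]Ak (invmx_unitary Pun).
have <- : row_perm s (col_perm s (E_ t)) =
    diag_mx (\row_j (if j == k then (1 - n%:R) * t else t)).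
  apply/matrixP => i j; rewrite mxE mxE EtE !mxE (inj_eq perm_inj).
  have -> : ((s i).+1 == n) = (i == k).
    have -> : ((s i).+1 == n) = (s i == Ordinal lt1).
      by apply/eqP/eqP => [h|->/=]; [apply/val_inj => /=; lia|lia].
    by rewrite -(tpermL k (Ordinal lt1)) (inj_eq perm_inj).
  by [].
by rewrite row_permE col_permE !mulmxA.
Qed.

Lemma E_moment t : moment (E_ t : 'M[R[i]]_n) = 0.
Proof.
apply/eqP; rewrite subr_eq0 tr_diag_mx map_diag_mx; apply/eqP.
exact: diag_mxC.
Qed.

Lemma moment_conj U A : U \is unitarymx ->
  moment (U *m A *m invmx U) = U *m moment A *m invmx U.
Proof.
move=> Uun; have Uu := unitarymx_unit Uun.
have cancel X Y : U *m X *m invmx U *m (U *m Y *m invmx U) = U *m (X *m Y) *m invmx U.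
  by rewrite !mulmxA mulmxKV.
rewrite /moment invmx_unitary// !adjM adjK -invmx_unitary// !(mulmxA U (A^t* )).
by rewrite !cancel mulmxBr mulmxBl.
Qed.

Lemma E_Zfiber t : Zfiber t (E_ t : 'M[R[i]]_n).
Proof.
have lt1 : (n.-1 < n)%N by lia.
pose l := Ordinal lt1.
have eql (j : 'I_n) : (j.+1 == n) = (j == l).
  by apply/eqP/eqP => [h|->/=]; [apply/val_inj => /=; lia|lia].
apply/(ZfiberP n_gt2); split.
  rewrite /E_ mxtrace_diag (bigD1 l)//= mxE eql eqxx.
  rewrite (eq_bigr (fun=> t)) => [|i il]; last by rewrite mxE eql (negbTE il).
  rewrite sumr_const cardC1 card_ord -mulr_natl.
  have -> : n%:R = 1 + n.-1%:R :> R[i]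
    by rewrite -[1](mulr1n 1) -mulrnDr; congr (_ *+ _); lia.
  by ring.
have -> : E_ t - t%:M = - (n%:R * t) *: delta_mx l l.
  apply/matrixP => i j; rewrite !mxE eql; case: (eqVneq i j) => [<-|ij].
    by case: (eqVneq i l) => _ /=; rewrite ?mulr1n ?mulr0 ?subrr//; ring.
  rewrite !mulr0n subrr; case: (eqVneq i l) => [il|_]; last by rewrite mulr0.
  by rewrite -il eq_sym (negbTE ij) mulr0.
by apply: leq_trans (mxrank_scale _ _) _; rewrite mxrank_delta.
Qed.

Lemma conj_Zfiber t U A : U \is unitarymx ->
  Zfiber t A -> Zfiber t (U *m A *m invmx U).
Proof.
move=> /unitarymx_unit Uu /(ZfiberP n_gt2)[trA rk]; apply/(ZfiberP n_gt2); split.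
  by rewrite mxtrace_mulC mulmxA mulVmx// mul1mx.
have -> : U *m A *m invmx U - t%:M = U *m (A - t%:M) *m invmx U.
  by rewrite mulmxBr mulmxBl scalar_mxC mulmxK//.
apply: leq_trans (mxrankM_maxl _ _) _.
exact: leq_trans (mxrankM_maxr _ _) rk.
Qed.

Lemma orbit_norm (a : R) t U : U \is unitarymx -> 0 <= a ->
  mxnorm (U *m E_ (a%:C * t) *m invmx U) = a * mxnorm (E_ t : 'M[R[i]]_n).
Proof.
move=> Uun a0; have Uu := unitarymx_unit Uun.
have -> : E_ (a%:C * t) = a%:C *: E_ t :> 'M[R[i]]_n.
  apply/matrixP => i j; rewrite [RHS]mxE !EtE mulrnAr.
  by case: ifP => // _; congr (_ *+ _); ring.
have aE : a = Num.sqrt (a ^+ 2) by rewrite sqrtr_sqr ger0_norm.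
rewrite /mxnorm [X in _ = X * _]aE -sqrtrM ?sqr_ge0//.
congr Num.sqrt; apply: (@complexI R); rewrite rmorphM rmorphXn/= -!tr_adj_mul.
rewrite !adjM adjZ conj_real invmx_unitary// adjK -invmx_unitary//.
rewrite -!mulmxA mxtrace_mulC -!mulmxA (mulmxA (invmx U)) mulVmx// mul1mx.
rewrite mulmx1.
by rewrite -scalemxAl -scalemxAr !mxtraceZ expr2 mulrA.
Qed.

End NormalForm.

(** * Explicit coefficients of a horizontal path *)

Section Algebra.
Context {F : fieldType} {n : nat}.
Context (N S : 'M[F]_n) (rho r2 : F).
Context (NN : N *m N = rho *: N) (SS : S *m S = rho *: S).
Context (NSN : N *m S *m N = r2 *: N) (SNS : S *m N *m S = r2 *: S).

(** For [S] the adjoint of a rank one matrix [N], this family contains the rank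
    one parts of the transports of [t I + N] when [\tr N > 0]. If [N = x y^*] with
    [|x| = |y|], it consists of the combinations of [x y^*], [x x^* + y y^*] and
    [y x^*], as is seen from [N S] and [S N]. *)
Definition span3 (a b c : F) : 'M[F]_n := a *: N + b *: (N *m S + S *m N) + c *: S.

(** In the notation above the condition on [a], [b], [c] makes the matrix a product
    of a combination of [x] and [y] by the adjoint of another one; without vectors,
    this is a factorization through [N]. *)
Lemma span3_rank a b c : (\rank N <= 1)%N -> a != 0 -> a * c = r2 * b ^+ 2 ->
  (\rank (span3 a b c) <= 1)%N.
Proof.
move=> rk a0 ac.
have -> : span3 a b c = a^-1 *: ((a%:M + b *: S) *m N *m (a%:M + b *: S)).
  rewrite !(mulmxDl, mulmxDr) !(mul_mx_scalar, mul_scalar_mx).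
  rewrite -!(scalemxAl, scalemxAr) SNS /span3.
  have -> : c = a^-1 * (r2 * b ^+ 2) by rewrite -ac mulKf.
  move: (N *m S) (S *m N) => P Q; apply/matrixP => i j; rewrite !mxE.
  by field.
apply: leq_trans (mxrank_scale _ _) _; apply: leq_trans (mxrankM_maxl _ _) _.
exact: leq_trans (mxrankM_maxr _ _) rk.
Qed.

Lemma span3_trace a b c : \tr N = rho -> \tr S = rho -> \tr (N *m S) = r2 ->
  \tr (span3 a b c) = rho * (a + c) + 2 * r2 * b.
Proof.
move=> tN tS tNS; rewrite /span3 !mxtraceD !mxtraceZ mxtraceD.
rewrite [\tr (S *m N)]mxtrace_mulC.
by rewrite tN tS tNS; ring.
Qed.

(** All commutators of [N], [S] and [N S + S N] are multiples of [N S - S N]; the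
    hypothesis is the vanishing of the resulting coefficient, which is half of the
    derivative of [(a - c) * (a + c + 2 * rho * b)]. That quantity is the factor by
    which the moment map of [N] gets multiplied, so within this family a path is
    horizontal as soon as its moment map is constant. *)
Lemma span3_comm a b c a' b' c' :
  a' * a + rho * (a' * b) + rho * (b' * a)
    - rho * (b' * c) - c' * c - rho * (c' * b) = 0 ->
  span3 a' b' c' *m span3 c b a = span3 c b a *m span3 a' b' c'.
Proof.
move=> coef; rewrite /span3.
have NK : N *m (N *m S + S *m N) = rho *: (N *m S) + r2 *: N.
  by rewrite mulmxDr !mulmxA NN NSN -scalemxAl.
have KN : (N *m S + S *m N) *m N = r2 *: N + rho *: (S *m N).
  by rewrite mulmxDl -[S *m N *m N]mulmxA NN NSN -scalemxAr.
have SK : S *m (N *m S + S *m N) = r2 *: S + rho *: (S *m N).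
  by rewrite mulmxDr !mulmxA SS SNS -scalemxAl.
have KS : (N *m S + S *m N) *m S = rho *: (N *m S) + r2 *: S.
  by rewrite mulmxDl -[N *m S *m S]mulmxA SS SNS -scalemxAr.
move: (N *m S + S *m N) NK KN SK KS => K NK KN SK KS.
rewrite !(mulmxDl, mulmxDr) -!(scalemxAl, scalemxAr) NN SS NK KN SK KS.
move: (N *m S) (S *m N) (K *m K) => P Q KK; apply/matrixP => i j; rewrite !mxE.
apply/eqP; rewrite -subr_eq0; apply/eqP.
rewrite -[RHS](mulr0 (P i j - Q i j)) -coef; ring.
Qed.

End Algebra.

Section Coefficients.
Context {R : realType}.

Lemma derivable_sqrt (f : R -> R) (u : R) : derivable f u 1 -> 0 < f u ->
  derivable (fun x => Num.sqrt (f x)) u 1.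
Proof.
move=> /derivableP df fu.
by have [] := is_derive1_comp (is_derive1_sqrt fu) df.
Qed.

(** Let [N = x y^*] with [|x|^2 = |y|^2 = r0] and [y^* x = rho0], and look for the
    transport in the form [(al x + be y) (al y + be x)^*] with real [al], [be], so that
    [a = al^2], [c = be^2] and [b = al be / r0]. Its trace has to be
    [rho = (1 - u) rho0]; let [r] be its norm and [D = al^2 - be^2]. Constancy of the
    moment map reads [D r = r0], and the Gram determinant of the two vectors gives
    [r^2 - rho^2 = D^2 (r0^2 - rho0^2)]. Eliminating [D] leaves the quadratic
    equation [r^2 (r^2 - rho^2) = r0^2 (r0^2 - rho0^2)] for [r^2], and then
    [(al + be)^2 = (r + rho) / (r0 + rho0)]. The last expression is also meaningful
    for [rho0 = r0], the case of a normal matrix. *)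
Lemma transport_coeffs (r0 rho0 : R) : 0 < rho0 -> rho0 <= r0 ->
  exists a b c : R -> R, [/\ a 0 = 1, b 0 = 0, c 0 = 0 &
    forall u, u < 1 ->
    [/\ 0 < a u, a u * c u = r0 ^+ 2 * b u ^+ 2,
        rho0 * (a u + c u) + 2 * r0 ^+ 2 * b u = (1 - u) * rho0 &
        exists a' b' c' : R,
        [/\ is_derive u 1 a a', is_derive u 1 b b', is_derive u 1 c c' &
         a' * a u + rho0 * (a' * b u) + rho0 * (b' * a u)
           - rho0 * (b' * c u) - c' * c u - rho0 * (c' * b u) = 0]]].
Proof.
move=> p0 pr; have r0p : 0 < r0 by exact: lt_le_trans pr.
pose rho (u : R) := (1 - u) * rho0.
pose k := r0 ^+ 2 * (r0 ^+ 2 - rho0 ^+ 2).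
have k0 : 0 <= k by rewrite /k; apply: mulr_ge0; nra.
pose disc (u : R) := rho u ^+ 2 * rho u ^+ 2 + 4 * k.
pose r2 (u : R) := 2^-1 * (rho u ^+ 2 + Num.sqrt (disc u)).
pose r (u : R) := Num.sqrt (r2 u).
(* m and q stand for the squares of al + be and al - be *)
pose m (u : R) := (r0 + rho0)^-1 * (r u + rho u).
pose D (u : R) := r0 * (r u)^-1.
pose q (u : R) := D u * D u * (m u)^-1.
pose a (u : R) := 2^-1 * (2^-1 * (m u + q u) + D u).
pose c (u : R) := 2^-1 * (2^-1 * (m u + q u) - D u).
pose b (u : R) := (4 * r0)^-1 * (m u - q u).
have rho_gt0 u : u < 1 -> 0 < rho u by move=> u1; rewrite mulr_gt0// subr_gt0.
have disc_gt0 u : u < 1 -> 0 < disc u.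
  move=> /rho_gt0 ru; apply: ltr_pwDl; [apply: mulr_gt0; exact: exprn_gt0|exact: mulr_ge0].
have r2_gt0 u : u < 1 -> 0 < r2 u.
  move=> /rho_gt0 ru; apply: mulr_gt0 => //; apply: ltr_pwDl; last exact: sqrtr_ge0.
  exact: exprn_gt0.
have r_gt0 u : u < 1 -> 0 < r u by move=> /r2_gt0; rewrite sqrtr_gt0.
have m_gt0 u : u < 1 -> 0 < m u.
  by move=> u1; rewrite mulr_gt0 ?invr_gt0 ?addr_gt0 ?rho_gt0 ?r_gt0.
have D_gt0 u : u < 1 -> 0 < D u.
  by move=> u1; rewrite mulr_gt0 ?invr_gt0 ?r_gt0.
have norm_eq u : u < 1 -> r u ^+ 2 * (r u ^+ 2 - rho u ^+ 2) = k.
  move=> u1; rewrite sqr_sqrtr ?ltW ?r2_gt0// /r2.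
  have := sqr_sqrtr (ltW (disc_gt0 u u1)); rewrite {2}/disc.
  by move: (Num.sqrt _) => x xE; lra.
have trace_eq u : u < 1 -> rho0 * (a u + c u) + 2 * r0 ^+ 2 * b u = rho u.
  move=> u1; have := norm_eq u u1; have := r_gt0 u u1; have := rho_gt0 u u1.
  rewrite /a /c /b /q /D /m; move: (r u) (rho u) => x y y0 x0 xE.
  have : x ^+ 2 * (x ^+ 2 - y ^+ 2) / (x ^+ 2 * (x + y)) = k / (x ^+ 2 * (x + y)).
    by rewrite xE.
  have -> : x ^+ 2 * (x ^+ 2 - y ^+ 2) / (x ^+ 2 * (x + y)) = x - y.
    by field; lra.
  move=> h; apply: (@addrI _ (2^-1 * (x - y))); rewrite {1}h /k; field.
  by do !(apply/andP; split); lra.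
have moment_eq u : u < 1 -> (a u - c u) * (a u + c u + 2 * rho0 * b u) = 1.
  move=> u1; have := norm_eq u u1; have := r_gt0 u u1; have := rho_gt0 u u1.
  rewrite /a /c /b /q /D /m; move: (r u) (rho u) => x y y0 x0 xE.
  have : x ^+ 2 * (x ^+ 2 - y ^+ 2) / (x ^+ 3 * (x + y)) = k / (x ^+ 3 * (x + y)).
    by rewrite xE.
  have -> : x ^+ 2 * (x ^+ 2 - y ^+ 2) / (x ^+ 3 * (x + y)) = 1 - y / x.
    by field; lra.
  move=> h; apply: (@addIr _ (2^-1 * (1 - y / x))); rewrite [in RHS]h /k; field.
  by do !(apply/andP; split); lra.
have r_0 : r 0 = r0.
  have rho_0 : rho 0 = rho0 by rewrite /rho; lra.
  have disc_0 : disc 0 = (2 * r0 ^+ 2 - rho0 ^+ 2) ^+ 2.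
    by rewrite /disc rho_0 /k; ring.
  rewrite /r /r2 disc_0 rho_0 sqrtr_sqr ger0_norm; last by nra.
  have -> : 2^-1 * (rho0 ^+ 2 + (2 * r0 ^+ 2 - rho0 ^+ 2)) = r0 ^+ 2 by lra.
  by rewrite sqrtr_sqr gtr0_norm.
have m_0 : m 0 = 1.
  by rewrite /m r_0 /rho subr0 mul1r mulVf//; lra.
have D_0 : D 0 = 1 by rewrite /D r_0 divff//; lra.
have q_0 : q 0 = 1 by rewrite /q D_0 m_0; lra.
exists a, b, c; split.
- by rewrite /a m_0 q_0 D_0; lra.
- by rewrite /b m_0 q_0; lra.
- by rewrite /c m_0 q_0 D_0; lra.
move=> u u1; split.
- have q0 : 0 < q u.
    apply: mulr_gt0; last by rewrite invr_gt0; exact: m_gt0.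
    by apply: mulr_gt0; exact: D_gt0.
  by rewrite /a; have := D_gt0 u u1; have := m_gt0 u u1; lra.
- rewrite /a /c /b /q; have := D_gt0 u u1; have := m_gt0 u u1.
  by move: (D u) (m u) => x y y0 x0; field; apply/andP; split; lra.
- exact: trace_eq.
have dcst (x : R) : derivable (fun=> x) u 1 by exact: derivable_cst.
have did : derivable (fun x : R => x) u 1 by exact: derivable_id.
have dA (f g : R -> R) : derivable f u 1 -> derivable g u 1 ->
  derivable (fun x => f x + g x) u 1 by exact: derivableD.
have dB (f g : R -> R) : derivable f u 1 -> derivable g u 1 ->
  derivable (fun x => f x - g x) u 1 by exact: derivableB.
have dM (f g : R -> R) : derivable f u 1 -> derivable g u 1 ->
  derivable (fun x => f x * g x) u 1 by exact: derivableM.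
have dV (f : R -> R) : f u != 0 -> derivable f u 1 ->
  derivable (fun x => (f x)^-1) u 1 by exact: derivableV.
have drho : derivable rho u 1.
  exact: (dM _ _ (dB _ _ (dcst 1) did) (dcst rho0)).
have drho2 := dM _ _ drho drho.
have ddisc : derivable disc u 1.
  exact: (dA _ _ (dM _ _ drho2 drho2) (dcst (4 * k))).
have dsq : derivable (fun x => Num.sqrt (disc x)) u 1.
  by apply: derivable_sqrt => //; exact: disc_gt0.
have dr2 : derivable r2 u 1 by exact: (dM _ _ (dcst 2^-1) (dA _ _ drho2 dsq)).
have dr : derivable r u 1 by apply: derivable_sqrt => //; exact: r2_gt0.
have dm : derivable m u 1 by exact: (dM _ _ (dcst _) (dA _ _ dr drho)).
have dD : derivable D u 1.
  exact: (dM _ _ (dcst _) (dV _ (lt0r_neq0 (r_gt0 u u1)) dr)).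
have dq : derivable q u 1.
  exact: (dM _ _ (dM _ _ dD dD) (dV _ (lt0r_neq0 (m_gt0 u u1)) dm)).
have dS : derivable (fun x => 2^-1 * (m x + q x)) u 1.
  exact: (dM _ _ (dcst _) (dA _ _ dm dq)).
have da : derivable a u 1 by exact: (dM _ _ (dcst _) (dA _ _ dS dD)).
have dc : derivable c u 1 by exact: (dM _ _ (dcst _) (dB _ _ dS dD)).
have db : derivable b u 1 by exact: (dM _ _ (dcst _) (dB _ _ dm dq)).
move: da db dc => /derivableP da /derivableP db /derivableP dc.
exists ('D_1 a u), ('D_1 b u), ('D_1 c u); split => //.
have dF := is_deriveM (is_deriveB da dc)
  (is_deriveD (is_deriveD da dc) (is_deriveM (is_derive_cst (2 * rho0) u 1) db)).
have dF0 : is_derive u (1 : R) (fun x => (a x - c x) * (a x + c x + 2 * rho0 * b x)) 0.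
  apply: (near_eq_is_derive _ (is_derive_cst (1 : R) u 1)).
  by near=> x; rewrite moment_eq//; near: x; exact: lt_nbhsl.
have : 0 = (a u - c u) * ('D_1 a u + 'D_1 c u + (2 * rho0 * 'D_1 b u + b u * 0))
    + (a u + c u + 2 * rho0 * b u) * ('D_1 a u - 'D_1 c u).
  have := @derive_val _ _ _ _ _ _ _ dF.
  by rewrite (@derive_val _ _ _ _ _ _ _ dF0).
move: ('D_1 a u) ('D_1 b u) ('D_1 c u) (a u) (b u) (c u) => a' b' c' x y z h; lra.
Unshelve. all: by end_near. Qed.

End Coefficients.

(** * Existence of parallel transport *)

Section Existence.
Local Open Scope complex_scope.
Local Open Scope sesquilinear_scope.
Context {R : realType} {n : nat}.
Context (n_gt2 : (2 < n)%N).
Implicit Types (A B X Y : 'M[R[i]]_n) (t : R[i]).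

Lemma polar_form (z : R[i]) : z != 0 ->
  exists (r : R) (w : R[i]), [/\ 0 < r, w != 0, Num.conj w * w = 1 & z = w * r%:C].
Proof.
move=> z0; have nz0 : `|z| != 0 by rewrite normr_eq0.
have nzE : `|z| = (complex.Re `|z|)%:C by rewrite RRe_real ?normr_real.
exists (complex.Re `|z|), (z / `|z|); split.
- by rewrite -ltcR -nzE normr_gt0.
- by rewrite mulf_neq0 ?invr_eq0.
- rewrite mulrC -normCK normrM normrV ?unitfE// normr_id divff// expr1n //.
- by rewrite -nzE divfK.
Qed.

Lemma velocity_radial t u : has_velocityC (radial_path t) u (- t).
Proof.
have d : has_velocityC (fun x : R => (1 - x)%:C) u (0 - 1)%:C.
  apply: velocityC_real;
    exact: (is_deriveB (is_derive_cst (1 : R) u 1) (is_derive_id u 1)).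
have := velocityCM d (velocityC_cst t u).
by rewrite mulr0 addr0 sub0r rmorphN rmorph1 mulN1r.
Qed.

(** The path itself is a curve exhibiting its velocity as a lift of that of the
    radial path, and commutation with the adjoint makes it orthogonal to the fiber. *)
Lemma lift_of_comm t (c : R -> 'M[R[i]]_n) u v : t != 0 -> u < 1 ->
  (forall x, x < 1 -> Zfiber (radial_path t x) (c x)) ->
  has_velocity c u v -> v *m (c u)^t* = (c u)^t* *m v ->
  horizontal_lift (c u) (- t) v.
Proof.
move=> t0 u1 cZ cv comm.
have g0 x : x < 1 -> radial_path t x != 0 by exact: radial_neq0.
have near1 : \forall x \near (0 : R), u + x < 1.
  have : \forall x \near (0 : R), x < 1 - u by apply: lt_nbhsl; rewrite subr_gt0.
  by apply: filterS => x; rewrite ltrBrDl.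
have chic x : x < 1 -> chi (c x) = radial_path t x by move=> /cZ [].
split; last first.
  move=> x; rewrite chic// => tx.
  exact: (comm_horizontal n_gt2 (g0 u u1) (cZ u u1) comm tx).
exists (fun x => c (u + x)); split.
- by rewrite addr0.
- by apply: filterS near1 => x x1; exact: (Zfiber_Zreg n_gt2 (g0 _ x1) (cZ _ x1)).
- exact: velocity_shift.
- apply: (velocityC_near _ (velocityC_shift (velocity_radial t u))).
  by apply: filterS near1 => x x1 /=; rewrite chic.
Qed.

(** The horizontal path is explicit: the rank one part of [y] is divided by the
    phase of its trace, which is constant along a radial path, and the quotient
    [N], of positive trace, is moved inside [span3 N N^*]. *)
Lemma transport_exists t s (y : 'M[R[i]]_n) : t != 0 -> s < 1 -> Zfiber t y ->
  exists z, transports (radial_path t) s y z.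
Proof.
move=> t0 s1 yZ; have [try rky] := (ZfiberP n_gt2 y t).1 yZ.
have tau0 := trace_neq0 n_gt2 t0.
have [p [w [p0 w0 ww tauE]]] := polar_form tau0.
pose N := w^-1 *: (y - t%:M).
have trN : \tr N = p%:C by rewrite mxtraceZ (Zfiber_trace n_gt2 yZ) tauE mulKf.
have rkN : (\rank N <= 1)%N by apply: leq_trans (mxrank_scale _ _) rky.
have yE : y = t%:M + w *: N by rewrite scalerA divff// scale1r addrC subrK.
clearbody N.
pose k := kahler_metric N N.
have [S [adjNE adjSE]] : exists S, N^t* = S /\ S^t* = N.
  by exists (N^t* ); rewrite adjK.
have SN : \tr (S *m N) = k%:C by rewrite -adjNE tr_adj_mul.
have trNS : \tr (N *m S) = k%:C by rewrite mxtrace_mulC.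
have NN : N *m N = p%:C *: N by have := rank1_sandwich 1%:M rkN; rewrite !mulmx1 trN.
have SS : S *m S = p%:C *: S by rewrite -adjNE -adjM NN adjZ conj_real.
have NSN : N *m S *m N = k%:C *: N.
  by rewrite (rank1_sandwich _ rkN) mxtrace_mulC SN.
have SNS : S *m N *m S = k%:C *: S.
  by have := congr1 (fun M => M^t* ) NSN;
    rewrite !adjM adjZ conj_real adjNE adjSE mulmxA.
have trS : \tr S = p%:C by rewrite -adjNE tr_adj trN conj_real.
(* half the squared norm of N - N^* is k - p ^+ 2 *)
have pk : p ^+ 2 <= k.
  have := kahler_norm_ge0 (N - S).
  rewrite kahler_metricE adjD adjN adjNE adjSE mulmxBl !mulmxBr NN SS.
  rewrite !raddfB/= !mxtraceZ trN trS SN [\tr (N *m S)]mxtrace_mulC SN.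
  rewrite -!rmorphM /=; nra.
have r0p : p <= Num.sqrt k.
  by rewrite -(ger0_norm (ltW p0)) -sqrtr_sqr ler_wsqrtr.
have kE : k = Num.sqrt k ^+ 2 by rewrite sqr_sqrtr// (le_trans _ pk) ?sqr_ge0.
have [a [b [c [a0 b0 c0 abc]]]] := transport_coeffs p0 r0p.
rewrite -kE in abc.
pose M (a b c : R) := span3 N S a%:C b%:C c%:C.
have MJ x1 x2 x3 : (M x1 x2 x3)^t* = M x3 x2 x1.
  rewrite /M /span3 !adjD !adjZ adjD !adjM adjNE adjSE !conj_real.
  by rewrite addrC (addrC (_ *: S)) addrA.
pose C u := (radial_path t u)%:M + w *: M (a u) (b u) (c u).
have CZ u : u < 1 -> Zfiber (radial_path t u) (C u).
  move=> /abc[au ac tr _]; apply/(ZfiberP n_gt2); split.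
    rewrite mxtraceD mxtrace_scalar mxtraceZ (span3_trace _ _ _ trN trS trNS).
    have -> : p%:C * ((a u)%:C + (c u)%:C) + 2 * k%:C * (b u)%:C = (1 - u)%:C * p%:C.
      by rewrite -[RHS]rmorphM -tr !(rmorphD, rmorphM)/= ?rmorph1 ?rmorph_nat.
    rewrite mulrCA -tauE -mulr_natl /radial_path; ring.
  rewrite /C addrC addKr.
  apply: leq_trans (mxrank_scale _ _) _; apply: (span3_rank SNS) => //.
    by rewrite eq_complex /= gt_eqF.
  by rewrite -rmorphM ac rmorphM rmorphXn.
have C0 : C 0 = y.
  rewrite /C a0 b0 c0 /M /span3 /radial_path subr0 mul1r scale0r scale0r.
  by rewrite scale1r !addr0 -yE.
exists (C s), C; split => //.
move=> u /andP[u0 us]; have u1 : u < 1 by exact: le_lt_trans s1.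
split.
- exact: (Zfiber_Zreg n_gt2 (radial_neq0 t0 u1) (CZ u u1)).
- by case: (CZ u u1).
have [_ _ _ [a' [b' [c' [da db dc coef]]]]] := abc u u1.
pose v := (- t)%:M + w *: M a' b' c'.
have dC : has_velocity C u v.
  apply: velocityD.
    move=> i j; rewrite mxE; under eq_fun do rewrite mxE.
    case: (i == j); rewrite ?mulr1n ?mulr0n; last exact: velocityC_cst.
    exact: velocity_radial.
  have dM : has_velocity (fun u => M (a u) (b u) (c u)) u (M a' b' c').
    by apply: velocityD; [apply: velocityD|]; apply: velocityZ; exact: velocityC_real.
  exact: velocity_scale.
exists (- t), v; split => //; first exact: velocity_radial.
apply: (lift_of_comm t0 u1 CZ dC).
rewrite /v /C adjD adj_scalar adjZ MJ.
have MM : M a' b' c' *m M (c u) (b u) (a u) = M (c u) (b u) (a u) *m M a' b' c'.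
  apply: (span3_comm NN SS NSN SNS); move/(congr1 (fun x => x%:C)): coef.
  by rewrite !(rmorphD, rmorphN, rmorphM).
move: (M a' b' c') (M (c u) (b u) (a u)) MM => X Y XY.
rewrite !(mulmxDl, mulmxDr) -!scalemxAl -!scalemxAr XY.
rewrite !(mul_scalar_mx, mul_mx_scalar) !scalerA.
apply/matrixP => i j; rewrite !mxE; ring.
Qed.

End Existence.

(** * The vanishing cycle *)

Section Vanishing.
Local Open Scope complex_scope.
Local Open Scope sesquilinear_scope.
Context {R : realType} {n : nat}.
Context (n_gt2 : (2 < n)%N).
Implicit Types (y z U : 'M[R[i]]_n) (t : R[i]).

(** Both facts hold for every horizontal path starting at [y], hence for the one that
    [parallel_transport] selects. *)
Lemma transports_end t s y z : t != 0 -> 0 <= s < 1 ->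
  transports (radial_path t) s y z ->
  Zfiber (radial_path t s) z /\ moment y = moment z.
Proof.
move=> t0 s01 [c [hc c0 cs]]; split.
  have ss : 0 <= s <= s by case/andP: s01 => s0 _; rewrite s0 lexx.
  by have [reg <- _] := hc s ss; rewrite -cs; exact: Zreg_Zfiber.
by rewrite -c0 -cs; exact: (horizontal_moment n_gt2 t0 s01 hc).
Qed.

(** The moment map of [y] is also that of its transports, which tend to [0]. *)
Lemma vanishing_moment t y : t != 0 -> L_ t y -> moment y = 0.
Proof.
move=> t0 [yZ def lim].
have yZ0 : Zfiber (radial_path t 0) y by rewrite /radial_path subr0 mul1r.
have val s : 0 <= s < 1 ->
    transports (radial_path t) s y (parallel_transport (radial_path t) s y).
  move=> s01; rewrite /parallel_transport; case: xgetP => [z _ //|none].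
  have [e e0 /(_ y yZ0)] := def s s01.
  by rewrite subrr /mxnorm (_ : kahler_metric 0 0 = 0) ?sqrtr0// => [/(_ e0)[z /none]|];
    rewrite // kahler_metricE mulmx0 mxtrace0.
have small (x : R) : (forall N, 0 <= N -> (exists2 s, 0 <= s < 1 &
    N = mxnorm (parallel_transport (radial_path t) s y)) ->
    `|x| <= N ^+ 2 *+ (2 * n)) -> x = 0.
  move=> xN; apply/eqP; rewrite -normr_le0 leNgt; apply/negP => x0.
  (* the bound 1 is there for N ^+ 2 <= N *)
  pose e := Num.min 1 (`|x| / (2 * n)%:R).
  have dn : 0 < (2 * n)%:R :> R by rewrite ltr0n; lia.
  have e0 : 0 < e by rewrite lt_min ltr01 divr_gt0.
  have lim_e : \forall s \near (1 : R)^'-,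
      mxnorm (parallel_transport (radial_path t) s y) < e.
    have := cvgr_lt 0 lim e e0; exact.
  have [s [s0 s1 se]] : exists s : R, [/\ 0 <= s, s < 1 &
      mxnorm (parallel_transport (radial_path t) s y) < e].
    near (1 : R)^'- => s; exists s; split.
    - by near: s; apply: nbhs_left_ge.
    - by near: s; exact: nbhs_left_lt.
    - by near: s.
  have s01 : 0 <= s < 1 by rewrite s0.
  move: se; set N := mxnorm _ => Ne; have N0 : 0 <= N by exact: sqrtr_ge0.
  have := xN N N0 (ex_intro2 _ _ s s01 erefl); apply/negP; rewrite -ltNge.
  rewrite -mulr_natr -ltr_pdivlMr//; move: Ne; rewrite lt_min => /andP[N1 Ne].
  by apply: le_lt_trans Ne; rewrite expr2 ler_piMr// ltW.
apply/matrixP => i j; rewrite [RHS]mxE.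
apply: complex_ext; apply: small => N N0 [s s01 NE];
  have [_ ->] := transports_end t0 s01 (val s s01);
  have := moment_bound (parallel_transport (radial_path t) s y) i j;
  by rewrite NE sqr_sqrtr ?kahler_norm_ge0// => -[].
Unshelve. all: by end_near. Qed.

(** The moment map of the transport at time [s] vanishes, so that this transport is
    unitarily conjugate to [E_ ((1 - s) t)] and its norm is proportional to [1 - s]. *)
Lemma orbit_vanishing t U : t != 0 -> U \is unitarymx ->
  L_ t (U *m E_ t *m invmx U).
Proof.
move=> t0 Uun; set y := U *m _ *m _.
have yZ : Zfiber t y by apply: conj_Zfiber => //; exact: E_Zfiber.
split => //.
  move=> s /andP[s0 s1]; exists 1 => // y' y'Z _.
  apply: (transport_exists n_gt2 t0 s1).
  by move: y'Z; rewrite /radial_path subr0 mul1r.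
have my : moment y = 0 by rewrite moment_conj// E_moment mulmx0 mul0mx.
have normE s : 0 <= s < 1 -> mxnorm (parallel_transport (radial_path t) s y) =
    (1 - s) * mxnorm (E_ t : 'M[R[i]]_n).
  move=> s01; have /andP[s0 s1] := s01.
  rewrite /parallel_transport; case: xgetP => [z _ /= tz|none]; last first.
    by have [z /none] := transport_exists n_gt2 t0 s1 yZ.
  have [zZ mz] := transports_end t0 s01 tz.
  have [|V Vun <-] := normal_orbit n_gt2 (radial_neq0 t0 s1) zZ.
    by rewrite normal_moment -mz my.
  by rewrite orbit_norm// subr_ge0 ltW.
have lin : (1 - s) * mxnorm (E_ t : 'M[R[i]]_n) @[s --> (1 : R)^'-] --> (0 : R).
  rewrite -(mul0r (mxnorm (E_ t : 'M[R[i]]_n))); apply: cvgMl.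
  rewrite -(subrr (1 : R)); apply: cvgB; first exact: cvg_cst.
  exact/cvg_at_left_filter/cvg_id.
apply: cvg_trans lin; apply: near_eq_cvg; near=> s; rewrite normE//.
apply/andP; split; near: s; [exact: nbhs_left_ge|exact: nbhs_left_lt].
Unshelve. all: by end_near. Qed.

End Vanishing.

Theorem lemma1p2 (R : realType) (n : nat) (t : R[i]) (hn : (2 < n)%N) (ht : t != 0) :
  L_ t = [set U *m E_ t *m invmx U | U in [set U : 'M[R[i]]_n | U \is unitarymx]].
Proof.
apply/seteqP; split=> [y yL|_ [U /= Uun <-]]; last exact: orbit_vanishing.
have [yZ _ _] := yL.
have [|U Uun UE] := normal_orbit hn ht yZ; last by exists U.
by rewrite normal_moment (vanishing_moment hn ht yL).
Qed.
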